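(* Let $m>0$, $c>0$, $\hbar>0$, and let $\varphi(x,t)=\exp\!\big[R(x,t)+\tfrac{i}{\hbar}S(x,t)\big]$, $x\in\mathbb{R}^3$, $t\ge 0$, with $R,S$ smooth and real-valued, be a solution of the Klein–Gordon equation $$\Delta\varphi-\frac{1}{c^2}\frac{\partial^2\varphi}{\partial t^2}=\frac{m^2c^2}{\hbar^2}\varphi$$ such that $S$ satisfies $$\frac{\partial S}{\partial t}+c\sqrt{m^2c^2+\nabla S\cdot\nabla S}=0 .$$ Write $x_\nu=(x,x^4)$ with $x^4=ict$, set $\tilde S(x_\nu)=S(x,t)$, $\tilde R(x_\nu)=R(x,t)$, let $\nabla_\nu=(\nabla,\partial/\partial x^4)$ and $\Delta_\nu=\nabla_\nu\cdot\nabla_\nu$, and let $\Sigma^2=\begin{pmatrix}\frac{\hbar}{m}I_3&0\\0&0\end{pmatrix}$. Consider the diffusion $\tilde X_\nu(\tau)$ with forward Itô differential $$d\tilde X_\nu(\tau)=\Big(\tfrac1m\nabla_\nu\tilde S+\Sigma^2\nabla_\nu\tilde R\Big)(\tilde X_\nu(\tau))\,d\tau+\Sigma\, d\tilde W_\nu(\tau),$$ with $\tilde W_\nu$ a standard four-dimensional Wiener process (equivalently, spatial part $d\tilde X=\big(\tfrac1m\nabla S+\tfrac{\hbar}{m}\nabla R\big)d\tau+\sqrt{\hbar/m}\,d\tilde W$ and time part $dT=-\tfrac{1}{mc^2}\tfrac{\partial S}{\partial t}\,d\tau$ where $\tilde X^4=icT$). Then $\tilde\rho(x_\nu)=|\varphi(x_\nu)|^2$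 is a stationary solution of the associated Fokker–Planck equation $$\frac{\partial\rho_\nu}{\partial\tau}+\nabla_\nu\cdot\Big[\Big(\tfrac1m\nabla_\nu\tilde S+\Sigma^2\nabla_\nu\tilde R\Big)\rho_\nu\Big]=\tfrac12\Sigma^2\Delta_\nu\rho_\nu,$$ so that $\mu(dx_\nu)=\tilde\rho(x_\nu)\,dx_\nu$ is an invariant ($\sigma$-finite) measure for this process; moreover $\tilde\rho$ satisfies the covariant continuity equation $$\nabla_\nu\cdot\Big(\tilde\rho\,\tfrac1m\nabla_\nu\tilde S\Big)=0,$$ i.e. $\nabla\cdot(|\varphi|^2\nabla S)-\frac{1}{c^2}\frac{\partial}{\partial t}\big(|\varphi|^2\frac{\partial S}{\partial t}\big)=0$.
   Context: Here $\nabla$ and $\Delta$ denote the spatial gradient and Laplacian on $\mathbb{R}^3$, and $\partial/\partial x^4=\frac{1}{ic}\partial/\partial t$ under the identification $x^4=ict$. In the expression $\tfrac12\Sigma^2\Delta_\nu\rho_\nu$, the matrix $\Sigma^2$ acts so that only the spatial second derivatives appear, i.e. it equals $\frac{\hbar}{2m}\Delta\rho_\nu$. *)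

(* Defs.v *)
From Stdlib Require Import Reals List.
From Coquelicot Require Import Coquelicot.
Open Scope R_scope.

(* Real functions of (x1, x2, x3, t) : R^3 x R. *)
Definition fn4 := R -> R -> R -> R -> R.

(* Partial derivative in direction i: 0,1,2 = spatial x1,x2,x3; 3 (and above) = t. *)
Definition pd (i : nat) (f : fn4) : fn4 :=
  fun x1 x2 x3 t =>
    match i with
    | 0%nat => Derive (fun y => f y x2 x3 t) x1
    | 1%nat => Derive (fun y => f x1 y x3 t) x2
    | 2%nat => Derive (fun y => f x1 x2 y t) x3
    | _ => Derive (fun y => f x1 x2 x3 y) t
    end.

Definition ex_pd (i : nat) (f : fn4) (x1 x2 x3 t : R) : Prop :=
  match i with
  | 0%nat => ex_derive (fun y => f y x2 x3 t) x1
  | 1%nat => ex_derive (fun y => f x1 y x3 t) x2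
  | 2%nat => ex_derive (fun y => f x1 x2 y t) x3
  | _ => ex_derive (fun y => f x1 x2 x3 y) t
  end.

Fixpoint iter_pd (l : list nat) (f : fn4) : fn4 :=
  match l with
  | nil => f
  | i :: l' => pd i (iter_pd l' f)
  end.

Definition uncurry4 (f : fn4) : R * R * R * R -> R :=
  fun p => f (fst (fst (fst p))) (snd (fst (fst p))) (snd (fst p)) (snd p).

Definition smooth4 (f : fn4) : Prop :=
  forall (l : list nat) (x1 x2 x3 t : R),
    continuous (uncurry4 (iter_pd l f)) (x1, x2, x3, t) /\
    forall i : nat, ex_pd i (iter_pd l f) x1 x2 x3 t.

Definition lap (f : fn4) : fn4 :=
  fun x1 x2 x3 t =>
    pd 0 (pd 0 f) x1 x2 x3 t + pd 1 (pd 1 f) x1 x2 x3 t + pd 2 (pd 2 f) x1 x2 x3 t.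

Definition gradSq (f : fn4) : fn4 :=
  fun x1 x2 x3 t =>
    (pd 0 f x1 x2 x3 t) ^ 2 + (pd 1 f x1 x2 x3 t) ^ 2 + (pd 2 f x1 x2 x3 t) ^ 2.

(* phi = exp(R + i S / hbar), written by real and imaginary parts. *)
Definition phi_re (hb : R) (Rf Sf : fn4) : fn4 :=
  fun x1 x2 x3 t => exp (Rf x1 x2 x3 t) * cos (Sf x1 x2 x3 t / hb).
Definition phi_im (hb : R) (Rf Sf : fn4) : fn4 :=
  fun x1 x2 x3 t => exp (Rf x1 x2 x3 t) * sin (Sf x1 x2 x3 t / hb).

Definition rho (hb : R) (Rf Sf : fn4) : fn4 :=
  fun x1 x2 x3 t => (phi_re hb Rf Sf x1 x2 x3 t) ^ 2 + (phi_im hb Rf Sf x1 x2 x3 t) ^ 2.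

Definition KG_residual (m c hb : R) (f : fn4) : fn4 :=
  fun x1 x2 x3 t =>
    lap f x1 x2 x3 t - / c ^ 2 * pd 3 (pd 3 f) x1 x2 x3 t
    - m ^ 2 * c ^ 2 / hb ^ 2 * f x1 x2 x3 t.

Definition drift (m hb : R) (Rf Sf : fn4) (i : nat) : fn4 :=
  fun x1 x2 x3 t => / m * pd i Sf x1 x2 x3 t + hb / m * pd i Rf x1 x2 x3 t.

(* nabla_nu . [ ((1/m) nabla_nu S~ + Sigma^2 nabla_nu R~) rho ], written out with
   d/dx^4 = (1/(i c)) d/dt, Sigma^2 killing the 4th component:
   = sum_i d_i (drift_i rho) - (1/(m c^2)) d_t (rho d_t S). *)
Definition FP_flux_div (m c hb : R) (Rf Sf : fn4) (r : fn4) : fn4 :=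
  fun x1 x2 x3 t =>
    pd 0 (fun a b d e => drift m hb Rf Sf 0 a b d e * r a b d e) x1 x2 x3 t
  + pd 1 (fun a b d e => drift m hb Rf Sf 1 a b d e * r a b d e) x1 x2 x3 t
  + pd 2 (fun a b d e => drift m hb Rf Sf 2 a b d e * r a b d e) x1 x2 x3 t
  - / (m * c ^ 2) * pd 3 (fun a b d e => r a b d e * pd 3 Sf a b d e) x1 x2 x3 t.

Definition cov_cont (c : R) (Sf : fn4) (r : fn4) : fn4 :=
  fun x1 x2 x3 t =>
    pd 0 (fun a b d e => r a b d e * pd 0 Sf a b d e) x1 x2 x3 t
  + pd 1 (fun a b d e => r a b d e * pd 1 Sf a b d e) x1 x2 x3 t
  + pd 2 (fun a b d e => r a b d e * pd 2 Sf a b d e) x1 x2 x3 t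
  - / c ^ 2 * pd 3 (fun a b d e => r a b d e * pd 3 Sf a b d e) x1 x2 x3 t.

(* Main.v *)
(* Writing phi = e^(R + i S/hbar), the imaginary part of phi^-1 times the
   Klein-Gordon equation is the covariant continuity equation
     sum_nu e^(-2R) d_nu (e^(2R) d_nu S) = 0,
   because the mass term m^2 c^2/hbar^2 is real.  Since rho = |phi|^2 = e^(2R),
   the osmotic part (hbar/m) grad R of the drift gives the flux
   (hbar/2m) grad rho, which exactly balances the diffusion term; what is left
   of the Fokker-Planck equation is (1/m) times the continuity equation. *)
Require Import Defs.
From Stdlib Require Import Reals FunctionalExtensionality.
From Coquelicot Require Import Coquelicot.
Open Scope R_scope.

Section OneVariable.
Variables (h : R) (r s : R -> R).
Hypothesis r_derivable : forall y, ex_derive r y.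
Hypothesis r'_derivable : forall y, ex_derive (Derive r) y.
Hypothesis s_derivable : forall y, ex_derive s y.
Hypothesis s'_derivable : forall y, ex_derive (Derive s) y.

Ltac eta_contract :=
  repeat match goal with |- context [fun x => ?f x] => change (fun x => f x) with f end.

Ltac derive_by_hand :=
  apply is_derive_unique; auto_derive;
  [ repeat split; first [ apply r_derivable | apply r'_derivable
                        | apply s_derivable | apply s'_derivable ]
  | eta_contract; unfold Rdiv; ring ].

Lemma Derive_exp_cos :
  Derive (fun y => exp (r y) * cos (s y / h))
  = fun y => exp (r y) * (Derive r y * cos (s y / h) - Derive s y / h * sin (s y / h)).
Proof. apply functional_extensionality; intro y; derive_by_hand. Qed.

Lemma Derive_exp_sin :
  Derive (fun y => exp (r y) * sin (s y / h))
  = fun y => exp (r y) * (Derive r y * sin (s y / h) + Derive s y / h * cos (s y / h)).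
Proof. apply functional_extensionality; intro y; derive_by_hand. Qed.

Lemma Derive2_exp_cos y :
  Derive (Derive (fun y => exp (r y) * cos (s y / h))) y
  = exp (r y) * ((Derive (Derive r) y + Derive r y ^ 2 - (Derive s y / h) ^ 2) * cos (s y / h)
                 - (Derive (Derive s) y + 2 * Derive r y * Derive s y) / h * sin (s y / h)).
Proof. rewrite Derive_exp_cos; derive_by_hand. Qed.

Lemma Derive2_exp_sin y :
  Derive (Derive (fun y => exp (r y) * sin (s y / h))) y
  = exp (r y) * ((Derive (Derive r) y + Derive r y ^ 2 - (Derive s y / h) ^ 2) * sin (s y / h)
                 + (Derive (Derive s) y + 2 * Derive r y * Derive s y) / h * cos (s y / h)).
Proof. rewrite Derive_exp_sin; derive_by_hand. Qed.

Lemma Derive2_exp_cis_Im y :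
  cos (s y / h) * Derive (Derive (fun y => exp (r y) * sin (s y / h))) y
  - sin (s y / h) * Derive (Derive (fun y => exp (r y) * cos (s y / h))) y
  = exp (r y) * (Derive (Derive s) y + 2 * Derive r y * Derive s y) / h.
Proof.
  rewrite Derive2_exp_cos, Derive2_exp_sin.
  pose proof (sin2_cos2 (s y / h)) as pythagoras; unfold Rsqr in pythagoras.
  match goal with |- _ = ?rhs =>
    transitivity (rhs * (sin (s y / h) * sin (s y / h) + cos (s y / h) * cos (s y / h)))
  end; [unfold Rdiv; ring | rewrite pythagoras; ring].
Qed.

Lemma Derive_exp2 :
  Derive (fun y => exp (2 * r y)) = fun y => exp (2 * r y) * (2 * Derive r y).
Proof. apply functional_extensionality; intro y; derive_by_hand. Qed.

Lemma Derive_exp2_mul (g : R -> R) y : ex_derive g y ->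
  Derive (fun y => exp (2 * r y) * g y) y
  = exp (2 * r y) * (Derive g y + 2 * Derive r y * g y).
Proof.
  intro g_derivable; apply is_derive_unique; auto_derive.
  - split; [apply r_derivable | split; [exact g_derivable | exact I]].
  - eta_contract; ring.
Qed.

Lemma Derive_drift_exp2 (a b : R) y :
  Derive (fun y => (a * Derive s y + b * Derive r y) * exp (2 * r y)) y
  = a * Derive (fun y => exp (2 * r y) * Derive s y) y
    + b / 2 * Derive (Derive (fun y => exp (2 * r y))) y.
Proof.
  rewrite Derive_exp2, !Derive_exp2_mul, Derive_scal.
  - apply is_derive_unique; auto_derive.
    + repeat split; first [apply r_derivable | apply r'_derivable | apply s'_derivable].
    + eta_contract; field.
  - auto_derive; auto.
  - apply s'_derivable.
Qed.
End OneVariable.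

Definition slice (i : nat) (f : fn4) (x1 x2 x3 t : R) : R -> R :=
  match i with
  | 0%nat => fun y => f y x2 x3 t
  | 1%nat => fun y => f x1 y x3 t
  | 2%nat => fun y => f x1 x2 y t
  | _ => fun y => f x1 x2 x3 y
  end.

Definition coord (i : nat) (x1 x2 x3 t : R) : R :=
  match i with 0%nat => x1 | 1%nat => x2 | 2%nat => x3 | _ => t end.

Lemma ex_derive_slice (f : fn4) (f_smooth : smooth4 f) l i x1 x2 x3 t y :
  ex_derive (slice i (iter_pd l f) x1 x2 x3 t) y.
Proof.
  destruct i as [|[|[|i]]].
  - exact (proj2 (f_smooth l y x2 x3 t) 0%nat).
  - exact (proj2 (f_smooth l x1 y x3 t) 1%nat).
  - exact (proj2 (f_smooth l x1 x2 y t) 2%nat).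
  - exact (proj2 (f_smooth l x1 x2 x3 y) (S (S (S i)))).
Qed.

(* Once [i] is a numeral, [slice i (pd i f)] and [Derive (slice i f)] reduce to
   the same function; the same device transfers each one-variable identity. *)
Lemma ex_derive_Derive_slice (f : fn4) (f_smooth : smooth4 f) i x1 x2 x3 t y :
  ex_derive (Derive (slice i f x1 x2 x3 t)) y.
Proof.
  pose proof (ex_derive_slice f f_smooth (cons i nil) i x1 x2 x3 t y) as H.
  destruct i as [|[|[|i]]]; exact H.
Qed.

Lemma rho_exp hb Rf Sf : rho hb Rf Sf = fun a b d e => exp (2 * Rf a b d e).
Proof.
  do 4 (apply functional_extensionality; intros ?).
  unfold rho, phi_re, phi_im.
  match goal with |- _ = exp (2 * ?r) =>
    replace (2 * r) with (r + r) by ring; rewrite exp_plus end.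
  match goal with |- context [sin ?theta] =>
    pose proof (sin2_cos2 theta) as pythagoras; unfold Rsqr in pythagoras end.
  rewrite <- (Rmult_1_r (exp _ * exp _)), <- pythagoras; ring.
Qed.

(* The contraction sum_nu F_nu F_nu in x_nu = (x, i c t), with d_4 = (1/(i c)) d_t. *)
Definition mink_contract (c : R) (F : nat -> R) : R :=
  F 0%nat + F 1%nat + F 2%nat - / c ^ 2 * F 3%nat.

Section PartialDerivatives.
Variables (Rf Sf : fn4).
Hypothesis Rf_smooth : smooth4 Rf.
Hypothesis Sf_smooth : smooth4 Sf.

Definition current_div (i : nat) : fn4 := fun x1 x2 x3 t =>
  pd i (pd i Sf) x1 x2 x3 t + 2 * pd i Rf x1 x2 x3 t * pd i Sf x1 x2 x3 t.

Lemma pd2_phi_Im hb i x1 x2 x3 t :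
  cos (Sf x1 x2 x3 t / hb) * pd i (pd i (phi_im hb Rf Sf)) x1 x2 x3 t
  - sin (Sf x1 x2 x3 t / hb) * pd i (pd i (phi_re hb Rf Sf)) x1 x2 x3 t
  = exp (Rf x1 x2 x3 t) * current_div i x1 x2 x3 t / hb.
Proof.
  pose proof (Derive2_exp_cis_Im hb (slice i Rf x1 x2 x3 t) (slice i Sf x1 x2 x3 t)
    (ex_derive_slice Rf Rf_smooth nil i x1 x2 x3 t)
    (ex_derive_Derive_slice Rf Rf_smooth i x1 x2 x3 t)
    (ex_derive_slice Sf Sf_smooth nil i x1 x2 x3 t)
    (ex_derive_Derive_slice Sf Sf_smooth i x1 x2 x3 t) (coord i x1 x2 x3 t)) as H.
  destruct i as [|[|[|i]]]; exact H.
Qed.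

Lemma pd_current i x1 x2 x3 t :
  pd i (fun a b d e => exp (2 * Rf a b d e) * pd i Sf a b d e) x1 x2 x3 t
  = exp (2 * Rf x1 x2 x3 t) * current_div i x1 x2 x3 t.
Proof.
  pose proof (Derive_exp2_mul (slice i Rf x1 x2 x3 t)
    (ex_derive_slice Rf Rf_smooth nil i x1 x2 x3 t)
    (Derive (slice i Sf x1 x2 x3 t)) (coord i x1 x2 x3 t)
    (ex_derive_Derive_slice Sf Sf_smooth i x1 x2 x3 t _)) as H.
  destruct i as [|[|[|i]]]; exact H.
Qed.

Lemma pd_drift_density m hb i x1 x2 x3 t :
  pd i (fun a b d e => drift m hb Rf Sf i a b d e * exp (2 * Rf a b d e)) x1 x2 x3 t
  = / m * pd i (fun a b d e => exp (2 * Rf a b d e) * pd i Sf a b d e) x1 x2 x3 t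
    + hb / (2 * m) * pd i (pd i (fun a b d e => exp (2 * Rf a b d e))) x1 x2 x3 t.
Proof.
  pose proof (Derive_drift_exp2 (slice i Rf x1 x2 x3 t) (slice i Sf x1 x2 x3 t)
    (ex_derive_slice Rf Rf_smooth nil i x1 x2 x3 t)
    (ex_derive_Derive_slice Rf Rf_smooth i x1 x2 x3 t)
    (ex_derive_Derive_slice Sf Sf_smooth i x1 x2 x3 t)
    (/ m) (hb / m) (coord i x1 x2 x3 t)) as H.
  replace (hb / (2 * m)) with (hb / m / 2) by (unfold Rdiv; rewrite Rinv_mult; ring).
  destruct i as [|[|[|i]]]; exact H.
Qed.

Lemma KG_residual_Im m c hb x1 x2 x3 t :
  cos (Sf x1 x2 x3 t / hb) * KG_residual m c hb (phi_im hb Rf Sf) x1 x2 x3 t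
  - sin (Sf x1 x2 x3 t / hb) * KG_residual m c hb (phi_re hb Rf Sf) x1 x2 x3 t
  = exp (Rf x1 x2 x3 t) / hb * mink_contract c (fun i => current_div i x1 x2 x3 t).
Proof.
  transitivity (mink_contract c (fun i =>
    cos (Sf x1 x2 x3 t / hb) * pd i (pd i (phi_im hb Rf Sf)) x1 x2 x3 t
    - sin (Sf x1 x2 x3 t / hb) * pd i (pd i (phi_re hb Rf Sf)) x1 x2 x3 t)).
  - unfold KG_residual, lap, mink_contract, phi_re, phi_im; ring.
  - unfold mink_contract; rewrite !pd2_phi_Im; unfold Rdiv; ring.
Qed.

Lemma KG_phase_equation m c hb x1 x2 x3 t : 0 < hb ->
  KG_residual m c hb (phi_re hb Rf Sf) x1 x2 x3 t = 0 ->
  KG_residual m c hb (phi_im hb Rf Sf) x1 x2 x3 t = 0 ->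
  mink_contract c (fun i => current_div i x1 x2 x3 t) = 0.
Proof.
  intros hb_pos KG_re KG_im.
  apply (Rmult_eq_reg_l (exp (Rf x1 x2 x3 t) / hb)).
  - rewrite Rmult_0_r, <- (KG_residual_Im m c hb), KG_re, KG_im; ring.
  - apply Rgt_not_eq, Rdiv_lt_0_compat; [apply exp_pos | exact hb_pos].
Qed.

Lemma cov_cont_rho c hb x1 x2 x3 t :
  cov_cont c Sf (rho hb Rf Sf) x1 x2 x3 t
  = exp (2 * Rf x1 x2 x3 t) * mink_contract c (fun i => current_div i x1 x2 x3 t).
Proof. rewrite rho_exp; unfold cov_cont, mink_contract; rewrite !pd_current; ring. Qed.

Lemma FP_flux_div_rho m c hb x1 x2 x3 t :
  FP_flux_div m c hb Rf Sf (rho hb Rf Sf) x1 x2 x3 t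
  = / m * cov_cont c Sf (rho hb Rf Sf) x1 x2 x3 t
    + hb / (2 * m) * lap (rho hb Rf Sf) x1 x2 x3 t.
Proof.
  rewrite rho_exp; unfold FP_flux_div, cov_cont, lap; rewrite !pd_drift_density.
  rewrite Rinv_mult; ring.
Qed.
End PartialDerivatives.

Theorem mainTheorem1 (m c hb : R) (Rf Sf : fn4) :
  0 < m -> 0 < c -> 0 < hb ->
  smooth4 Rf -> smooth4 Sf ->
  (* phi = exp(R + i S/hbar) solves Klein-Gordon (real and imaginary parts) *)
  (forall x1 x2 x3 t, 0 <= t -> KG_residual m c hb (phi_re hb Rf Sf) x1 x2 x3 t = 0) ->
  (forall x1 x2 x3 t, 0 <= t -> KG_residual m c hb (phi_im hb Rf Sf) x1 x2 x3 t = 0) ->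
  (* dS/dt + c sqrt(m^2 c^2 + grad S . grad S) = 0 *)
  (forall x1 x2 x3 t, 0 <= t ->
     pd 3 Sf x1 x2 x3 t + c * sqrt (m ^ 2 * c ^ 2 + gradSq Sf x1 x2 x3 t) = 0) ->
  (* stationary Fokker-Planck equation (d rho/d tau = 0) *)
  (forall x1 x2 x3 t, 0 <= t ->
     FP_flux_div m c hb Rf Sf (rho hb Rf Sf) x1 x2 x3 t
     = hb / (2 * m) * lap (rho hb Rf Sf) x1 x2 x3 t)
  /\
  (* covariant continuity equation *)
  (forall x1 x2 x3 t, 0 <= t -> cov_cont c Sf (rho hb Rf Sf) x1 x2 x3 t = 0).
Proof.
  (* The Hamilton-Jacobi constraint only fixes the direction of the time
     component of the drift; neither equation depends on it. *)
  intros _ _ hb_pos Rf_smooth Sf_smooth KG_re KG_im _.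
  assert (continuity : forall x1 x2 x3 t, 0 <= t ->
            cov_cont c Sf (rho hb Rf Sf) x1 x2 x3 t = 0).
  { intros x1 x2 x3 t t_nonneg.
    rewrite cov_cont_rho, (KG_phase_equation Rf Sf Rf_smooth Sf_smooth m c hb);
      auto using Rmult_0_r. }
  split; [|exact continuity].
  intros x1 x2 x3 t t_nonneg.
  rewrite FP_flux_div_rho, continuity by assumption; ring.
Qed.
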